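(* Let $g\geq 3$, let $G_g=\pi_1(N_g,z)$, and let $i:S^1\vee S^1\hookrightarrow N_g$ be the figure-eight embedding in a once-holed torus $T\subset N_g$ described in the context, inducing an injection $i_*:F_2\to G_g$. For every $n\geq 2$, the restriction map $i^*:H_b^n(G_g)\to H_b^n(F_2)$ admits an isometric (seminorm-preserving) linear right inverse $$J_g^n:H_b^n(F_2)\longrightarrow H_b^n(G_g),\qquad i^*J_g^n=\mathrm{Id}.$$ It descends to an isometric linear map $$\overline J_g^n:\overline{EH}_b^n(F_2)\longrightarrow\overline{EH}_b^n(G_g),\qquad i^n\,\overline J_g^n=\mathrm{Id},$$ where $i^n:\overline{EH}_b^n(G_g)\to\overline{EH}_b^n(F_2)$ is the map induced by $i_*$. Thus $i^n$ is surjective also for $g=3$.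
   Context: $N_g$ is the closed non-orientable surface of genus $g$. Put $m=g-2$ and decompose $N_g=T\cup_\delta N_{m,1}$, where $T\cong\Sigma_{1,1}$ is a compact orientable once-holed torus, $N_{m,1}$ is a compact non-orientable surface of genus $m$ with one boundary component, and $\delta=\partial T=\partial N_{m,1}$. Let $\alpha,\beta\subset T$ be meridian and longitude loops meeting transversely only at the basepoint $z$, whose union is a deformation retract of $T$; $i$ is the embedding of $S^1\vee S^1$ with image $\alpha\cup\beta$. With $a,b$ the based classes of $\alpha,\beta$, one has $G_g=\langle a,b,c_1,\ldots,c_m\mid[a,b]c_1^2\cdots c_m^2=1\rangle$, and $i_*$ identifies $F_2$ with the free subgroup $\langle a,b\rangle$. All coefficients are trivial real. $H_b^n(G)$ is the cohomology of the complex of bounded functions $G^{n+1}\to\mathbb{R}$ invariant under the diagonal left action of $G$, with the usual homogeneous coboundary, equipped with the seminorm $\|\xi\|=\inf\{\|c\|_\infty:[c]=\xi\}$. $N^n(G)$ is the subspace of zero-seminorm classes; $EH_b^n(G)=\ker(H_b^n(G)\to H^n(G;\mathbb{R}))$ is the kernel of the comparison map; $\overline{EH}_b^n(G)=EH_b^n(G)/(EH_b^n(G)\cap N^n(G))$ with the induced norm. Group homomorphisms induce pullbacks on all these spaces. *)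

(* Defs.v *)
From HB Require Import structures.
From mathcomp Require Import all_boot all_order all_algebra.
From mathcomp Require Import boolp classical_sets functions reals.
Set Implicit Arguments.
Unset Strict Implicit.
Unset Printing Implicit Defensive.
Import Order.TTheory GRing.Theory Num.Theory.
Local Open Scope ring_scope.
Local Open Scope quotient_scope.

(* The letter (x, false) stands for the generator x, (x, true) for x^-1. *)
Definition word (X : Type) := seq (X * bool).

Section Presentation.
Variables (X : choiceType) (rel : set (word X)).

Inductive word_eq : word X -> word X -> Prop :=
| WordRefl u : word_eq u u
| WordSym u v : word_eq u v -> word_eq v u
| WordTrans u v w : word_eq u v -> word_eq v w -> word_eq u w
| WordCat u u' v v' : word_eq u u' -> word_eq v v' -> word_eq (u ++ v) (u' ++ v')
| WordCancel x e : word_eq [:: (x, e); (x, ~~ e)] [::]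
| WordRel r : rel r -> word_eq r [::].

Definition word_eqb (u v : word X) : bool := `[< word_eq u v >].

Lemma word_eqb_equiv : equiv_class_of word_eqb.
Proof.
split=> [u|u v|v u w].
- by apply/asboolP; exact: WordRefl.
- by apply/asboolP/asboolP => /WordSym.
- move=> /asboolP uv /asboolP vw; apply/asboolP; exact: WordTrans uv vw.
Qed.
Canonical word_eqb_equivRel := EquivRelPack word_eqb_equiv.
Canonical word_eqb_encModRel := defaultEncModRel word_eqb.

Definition presented := {eq_quot word_eqb}.
HB.instance Definition _ : EqQuotient (word X) word_eqb presented :=
  EqQuotient.on presented.
HB.instance Definition _ := Choice.on presented.

Lemma presented_eqP (u v : word X) :
  reflect (word_eq u v) (\pi_presented u == \pi_presented v).
Proof. by rewrite piE; exact: asboolP. Qed.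

Lemma presentedW (P : presented -> Prop) :
  (forall u, P (\pi_presented u)) -> forall x, P x.
Proof. by move=> h x; rewrite -[x]reprK. Qed.

Definition word_inv (u : word X) : word X := rev [seq (l.1, ~~ l.2) | l <- u].

Lemma word_inv_cat u v : word_inv (u ++ v) = word_inv v ++ word_inv u.
Proof. by rewrite /word_inv map_cat rev_cat. Qed.

Lemma word_invK : involutive word_inv.
Proof.
move=> u; rewrite /word_inv map_rev revK -map_comp -[RHS]map_id.
by apply: eq_map => -[x e] /=; rewrite negbK.
Qed.

Lemma word_mulV u : word_eq (u ++ word_inv u) [::].
Proof.
elim: u => [|[x e] u IHu]; first exact: WordRefl.
rewrite -[(x, e) :: u]/([:: (x, e)] ++ u) word_inv_cat -catA (catA u).
apply: (WordTrans _ (WordCancel x e)).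
rewrite -[[:: (x, e); _]]/([:: (x, e)] ++ [::] ++ [:: (x, ~~ e)]).
apply: WordCat; first exact: WordRefl.
by apply: WordCat => //; exact: WordRefl.
Qed.

Lemma word_mulVl u : word_eq (word_inv u ++ u) [::].
Proof. by have := word_mulV (word_inv u); rewrite word_invK. Qed.

Lemma word_inv_eq u v : word_eq u v -> word_eq (word_inv u) (word_inv v).
Proof.
move=> uv.
have h1 : word_eq (word_inv u) (word_inv u ++ (v ++ word_inv v)).
  rewrite -{1}[word_inv u]cats0; apply: WordCat; first exact: WordRefl.
  exact/WordSym/word_mulV.
apply: WordTrans h1 _; rewrite catA -[X in word_eq _ X]cat0s.
apply: WordCat; last exact: WordRefl.
apply: WordTrans (word_mulVl u).
by apply: WordCat; [exact: WordRefl | exact: WordSym].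
Qed.

Definition presented_one : presented := \pi_presented [::].
Definition presented_mul (x y : presented) : presented :=
  \pi_presented (repr x ++ repr y).
Definition presented_inv (x : presented) : presented :=
  \pi_presented (word_inv (repr x)).

Lemma presented_repr u : word_eq (repr (\pi_presented u)) u.
Proof. by apply/presented_eqP; rewrite reprK. Qed.

Lemma presented_mulE u v :
  presented_mul (\pi_presented u) (\pi_presented v) = \pi_presented (u ++ v).
Proof. by apply/eqP/presented_eqP; apply: WordCat; exact: presented_repr. Qed.

Lemma presented_invE u :
  presented_inv (\pi_presented u) = \pi_presented (word_inv u).
Proof. by apply/eqP/presented_eqP/word_inv_eq/presented_repr. Qed.

Let mulA : associative presented_mul.
Proof.
move=> x y z; elim/presentedW: x => u; elim/presentedW: y => v; elim/presentedW: z => w.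
by rewrite !presented_mulE catA.
Qed.
Let mul1 : left_id presented_one presented_mul.
Proof. by move=> x; elim/presentedW: x => u; rewrite presented_mulE. Qed.
Let mulr1 : right_id presented_one presented_mul.
Proof. by move=> x; elim/presentedW: x => u; rewrite presented_mulE cats0. Qed.
Let mulV : left_inverse presented_one presented_inv presented_mul.
Proof.
move=> x; elim/presentedW: x => u; rewrite presented_invE presented_mulE.
exact/eqP/presented_eqP/word_mulVl.
Qed.
Let mulrV : right_inverse presented_one presented_inv presented_mul.
Proof.
move=> x; elim/presentedW: x => u; rewrite presented_invE presented_mulE.
exact/eqP/presented_eqP/word_mulV.
Qed.
HB.instance Definition _ :=
  isGroup.Build presented mulA mul1 mulr1 mulV mulrV.

Lemma pi_mulg u v :
  (\pi_presented u * \pi_presented v)%g = \pi_presented (u ++ v).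
Proof. exact: presented_mulE. Qed.

Lemma pi_invg u : ((\pi_presented u)^-1)%g = \pi_presented (word_inv u).
Proof. exact: presented_invE. Qed.

Definition gen (x : X) : presented := \pi_presented [:: (x, false)].

End Presentation.

Definition free_group (X : choiceType) := presented (X := X) set0.
HB.instance Definition _ (X : choiceType) := Group.on (free_group X).

Section FreeLift.
Variables (X : choiceType) (H : groupType) (f : X -> H).

Definition word_eval (u : word X) : H :=
  foldr (fun l h => ((if l.2 then (f l.1)^-1 else f l.1) * h)%g) 1%g u.

Lemma word_eval_cat u v : word_eval (u ++ v) = (word_eval u * word_eval v)%g.
Proof. by elim: u => [|l u IHu] /=; rewrite ?mul1g // IHu mulgA. Qed.

Lemma word_eval_eq u v : word_eq set0 u v -> word_eval u = word_eval v.
Proof.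
elim=> // [a b c _ -> _ -> //|a a' b b' _ h1 _ h2|x []].
- by rewrite !word_eval_cat h1 h2.
- by rewrite /= mulg1 mulVg.
- by rewrite /= mulg1 mulgV.
Qed.

Definition free_lift (x : free_group X) : H := word_eval (repr x).

Lemma free_lift_pi u : free_lift (\pi_(presented set0) u) = word_eval u.
Proof. by apply: word_eval_eq; exact: presented_repr. Qed.

Lemma free_lift_gen x : free_lift (gen set0 x) = f x.
Proof. by rewrite free_lift_pi /= mulg1. Qed.

Lemma free_liftM : {morph free_lift : x y / (x * y)%g}.
Proof.
move=> x y; elim/presentedW: x => u; elim/presentedW: y => v.
by rewrite [(_ * _)%g]presented_mulE !free_lift_pi word_eval_cat.
Qed.
HB.instance Definition _ :=
  isMultiplicative.Build (free_group X) H free_lift free_liftM.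

End FreeLift.

(* The fundamental group of the figure eight, free on the two loops. *)
Definition F2 := free_group 'I_2.
HB.instance Definition _ := Group.on F2.

(* inl 0 = a and inl 1 = b are the classes of the two loops in the once-holed
   torus T; inr j = c_(j+1) are the one-sided generators of N_{m,1}, m = g - 2. *)
Definition surface_gen (g : nat) : choiceType := ('I_2 + 'I_(g - 2))%type.

(* [a, b] c_1^2 ... c_m^2, with [a, b] = a b a^-1 b^-1 *)
Definition surface_relator (g : nat) : word (surface_gen g) :=
  let a := inl ord0 : surface_gen g in
  let b := inl ord_max : surface_gen g in
  [:: (a, false); (b, false); (a, true); (b, true)] ++
  flatten [seq [:: (inr j, false); (inr j, false)] | j <- enum 'I_(g - 2)].

(* The fundamental group of the closed non-orientable surface of genus g, in the
   standard presentation coming from N_g = T \cup N_{m,1}; meaningful for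
   3 <= g. *)
Definition pi1_N (g : nat) := presented [set surface_relator g].
HB.instance Definition _ (g : nat) := Group.on (pi1_N g).

(* Induced by the inclusion of the figure eight in T: it sends the two free
   generators to a and b. *)
Definition i_star (g : nat) : F2 -> pi1_N g :=
  free_lift (fun s : 'I_2 => gen [set surface_relator g] (inl s)).
HB.instance Definition _ (g : nat) := Multiplicative.on (i_star g).

Section LinearQuotient.
Variables (R : pzRingType) (V : lmodType R) (W : submodClosed V).

(* Over a ring a submodClosed predicate is closed under opposites, but this is
   not inferred by the library. *)
Definition lquot_pred : {pred V} := W.
HB.instance Definition _ :=
  GRing.isSubmodClosed.Build R V lquot_pred (submodClosedP W).

Definition lquot := Quotient.quot lquot_pred.
HB.instance Definition _ : EqQuotient V (Quotient.equiv lquot_pred) lquot :=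
  EqQuotient.on lquot.
HB.instance Definition _ := GRing.Zmodule.on lquot.

Lemma lquot_eqP (u v : V) :
  reflect (\pi_lquot u = \pi_lquot v) (u - v \in W).
Proof.
rewrite (_ : (u - v \in W) = (\pi_lquot u == \pi_lquot v)); first exact: eqP.
exact: (Quotient.idealrBE lquot_pred u v).
Qed.

Lemma lquotW (P : lquot -> Prop) :
  (forall v, P (\pi_lquot v)) -> forall x, P x.
Proof. by move=> h x; rewrite -[x]reprK. Qed.

Lemma lquot_piD (u v : V) : \pi_lquot (u + v) = \pi_lquot u + \pi_lquot v.
Proof. exact: (Quotient.pi_add lquot_pred u v). Qed.

Lemma lquot_pi0 : \pi_lquot 0 = 0.
Proof. by apply: (addrI (\pi_lquot 0)); rewrite -lquot_piD !addr0. Qed.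

Definition lquot_scale (a : R) (x : lquot) : lquot := \pi_lquot (a *: repr x).

Lemma lquot_scaleE (a : R) (v : V) :
  lquot_scale a (\pi_lquot v) = \pi_lquot (a *: v).
Proof.
apply/lquot_eqP; rewrite -scalerBr; apply: rpredZ.
by apply/lquot_eqP; rewrite reprK.
Qed.

Let scaleA (a b : R) x : lquot_scale a (lquot_scale b x) = lquot_scale (a * b) x.
Proof. by elim/lquotW: x => v; rewrite !lquot_scaleE scalerA. Qed.
Let scale1 : left_id 1 lquot_scale.
Proof. by move=> x; elim/lquotW: x => v; rewrite lquot_scaleE scale1r. Qed.
Let scaleDr : right_distributive lquot_scale +%R.
Proof.
move=> a x y; elim/lquotW: x => u; elim/lquotW: y => v.
by rewrite -lquot_piD !lquot_scaleE scalerDr lquot_piD.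
Qed.
Let scaleDl x : {morph lquot_scale^~ x : a b / a + b}.
Proof.
by elim/lquotW: x => v a b; rewrite /= !lquot_scaleE scalerDl lquot_piD.
Qed.
HB.instance Definition _ :=
  GRing.Zmodule_isLmodule.Build R lquot scaleA scale1 scaleDr scaleDl.

Lemma lquot_pi_linear : linear \pi_lquot.
Proof. by move=> a u v; rewrite lquot_piD -lquot_scaleE. Qed.

Lemma lquot_eq0 (v : V) : (\pi_lquot v == 0) = (v \in W).
Proof. by rewrite -lquot_pi0; apply/eqP/idP => [/lquot_eqP|?]; [|apply/lquot_eqP]; rewrite subr0. Qed.

End LinearQuotient.

Section LinearQuotientMap.
Variables (R : pzRingType) (V V' : lmodType R).
Variables (W : submodClosed V) (W' : submodClosed V').

(* [v] |-> [f v]; independent of the representative as soon as f maps W to W' *)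
Definition lquot_map (f : V -> V') (x : lquot W) : lquot W' :=
  \pi_(lquot W') (f (repr x)).

Hypothesis (f : {linear V -> V'}).
Hypothesis fW : forall v, v \in W -> f v \in W'.

Lemma lquot_mapE v : lquot_map f (\pi_(lquot W) v) = \pi_(lquot W') (f v).
Proof.
by apply/lquot_eqP; rewrite -linearB; apply/fW/lquot_eqP; rewrite reprK.
Qed.

Lemma lquot_map_linear : linear (lquot_map f).
Proof.
move=> a x y; elim/lquotW: x => u; elim/lquotW: y => v.
by rewrite -lquot_pi_linear !lquot_mapE linearP lquot_pi_linear.
Qed.

End LinearQuotientMap.
Arguments lquot_map {R V V' W W'} f x.

Section Seminorm.
Variables (R : realType) (V : lmodType R).

Definition is_seminorm (p : V -> R) : Prop :=
  [/\ forall v, 0 <= p v,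
      forall u v, p (u + v) <= p u + p v &
      forall a v, p (a *: v) = `|a| * p v].

Lemma seminorm_zero_submod (p : V -> R) :
  is_seminorm p -> submod_closed [pred v | p v == 0].
Proof.
move=> [p0 pD pZ]; split=> [|a u v]; rewrite !inE.
  by rewrite -(scale0r 0) pZ normr0 mul0r.
move=> /eqP pu /eqP pv; rewrite eq_le p0 andbT.
by apply: le_trans (pD _ _) _; rewrite pZ pu pv mulr0 addr0.
Qed.

End Seminorm.

Section QuotientSeminorm.
Variables (R : realType) (V : lmodType R) (W : submodClosed V) (p : V -> R).
Local Open Scope classical_set_scope.

Definition quot_seminorm (x : lquot W) : R :=
  inf [set p v | v in [set v | \pi_(lquot W) v = x]].

Hypothesis psn : is_seminorm p.

Lemma quot_seminorm_has_lbound x :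
  has_lbound [set p v | v in [set v | \pi_(lquot W) v = x]].
Proof. by exists 0 => _ [v _ <-]; case: psn. Qed.

Lemma quot_seminorm_le v : quot_seminorm (\pi_(lquot W) v) <= p v.
Proof. by apply: ge_inf; [exact: quot_seminorm_has_lbound | exists v]. Qed.

Lemma quot_seminorm_ge x r :
  (forall v, \pi_(lquot W) v = x -> r <= p v) -> r <= quot_seminorm x.
Proof.
move=> h; apply: lb_le_inf; last by move=> _ [v /h + <-].
by exists (p (repr x)), (repr x) => //=; rewrite reprK.
Qed.

Lemma quot_seminorm_is_seminorm : is_seminorm quot_seminorm.
Proof.
have [p0 pD pZ] := psn; split=> [x|x y|a x].
- by apply: quot_seminorm_ge => v _.
- rewrite -lerBlDr; apply: quot_seminorm_ge => u ux.
  rewrite lerBlDr -lerBlDl; apply: quot_seminorm_ge => v vy.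
  rewrite lerBlDl; apply: le_trans (pD u v).
  by rewrite -ux -vy -lquot_piD; exact: quot_seminorm_le.
- have hle b y : quot_seminorm (b *: y) <= `|b| * quot_seminorm y.
    have [->|b0] := eqVneq b 0.
      rewrite scale0r normr0 mul0r -lquot_pi0.
      apply: le_trans (quot_seminorm_le 0) _.
      by rewrite -(scale0r 0) pZ normr0 mul0r.
    rewrite mulrC -ler_pdivrMr ?normr_gt0//; apply: quot_seminorm_ge => v vy.
    rewrite ler_pdivrMr ?normr_gt0// mulrC -pZ -vy.
    rewrite (_ : b *: _ = \pi_(lquot W) (b *: v)).
      exact: quot_seminorm_le.
    by rewrite -[b *: v]addr0 lquot_pi_linear lquot_pi0 addr0.
  apply/eqP; rewrite eq_le hle /=.
  have [->|a0] := eqVneq a 0.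
    by rewrite normr0 mul0r; apply: quot_seminorm_ge => v _; exact: p0.
  rewrite mulrC -ler_pdivlMr ?normr_gt0// mulrC -normfV.
  by rewrite -{1}(scale1r x) -(mulVf a0) -scalerA; exact: hle.
Qed.

End QuotientSeminorm.
Arguments quot_seminorm {R V W} p x.
Arguments quot_seminorm_le {R V W p} psn v.
Arguments quot_seminorm_ge {R V W p x r} h.
Arguments quot_seminorm_is_seminorm {R V W p} psn.

Section Cohomology.
Variables (R : realType) (G : groupType).

Definition homog_fun (n : nat) := ('I_n.+1 -> G) -> R^o.
HB.instance Definition _ n := GRing.Lmodule.on (homog_fun n).

Definition invariant n (f : homog_fun n) : Prop :=
  forall (h : G) x, f (fun i => (h * x i)%g) = f x.

Definition bounded n (f : homog_fun n) : Prop :=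
  exists M : R, forall x, `|f x| <= M.

(* For b = true the bounded cochains, for b = false all the cochains *)
Definition cochains (b : bool) n : {pred homog_fun n} :=
  fun f => `[< invariant f /\ (b -> bounded f) >].
Arguments cochains b n f : clear implicits.

(* lift i enumerates 'I_n.+2 without i: the i-th argument is omitted *)
Definition coboundary n (f : homog_fun n) : homog_fun n.+1 :=
  fun x => \sum_(i < n.+2) (-1) ^+ i * f (fun j => x (lift i j)).

Definition cocycles b n : {pred homog_fun n} :=
  fun f => (f \in cochains b n) && (coboundary f == 0).
Arguments cocycles b n f : clear implicits.

Definition coboundaries b n : {pred homog_fun n} :=
  match n with
  | 0 => fun f => f == 0
  | k.+1 => fun f => `[< exists2 h, h \in cochains b k & f = coboundary h >]
  end.
Arguments coboundaries b n f : clear implicits.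

Lemma coboundary_linear n : linear (@coboundary n).
Proof.
move=> a f g; apply/funext => x; rewrite /coboundary.
rewrite [RHS](_ : _ = a * (\sum_(i < n.+2) (-1) ^+ i * f (fun j => x (lift i j)))
  + \sum_(i < n.+2) (-1) ^+ i * g (fun j => x (lift i j)))//.
rewrite mulr_sumr -big_split /=; apply: eq_bigr => i _.
rewrite [(a *: f + g) _](_ : _ = a * f (fun j => x (lift i j)) + g (fun j => x (lift i j)))//.
by rewrite mulrDr mulrCA.
Qed.
HB.instance Definition _ n :=
  GRing.isLinear.Build R (homog_fun n) (homog_fun n.+1) _ (@coboundary n)
    (@coboundary_linear n).

Lemma cochains_submod b n : submod_closed (cochains b n).
Proof.
split=> [|a f g].
  by apply/asboolP; split=> // _; exists 0 => x; rewrite normr0.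
move=> /asboolP[fi fb] /asboolP[gi gb]; apply/asboolP; split=> [h x|].
  by rewrite -[LHS]/(a * f _ + g _) fi gi.
move=> bT; have [M hM] := fb bT; have [N hN] := gb bT.
exists (`|a| * M + N) => x; rewrite -[(a *: f + g) x]/(a * f x + g x).
apply: le_trans (ler_normD _ _) _; rewrite lerD// normrM.
exact: ler_wpM2l.
Qed.
HB.instance Definition _ b n :=
  GRing.isSubmodClosed.Build R (homog_fun n) (cochains b n)
    (cochains_submod b n).

Lemma cocycles_submod b n : submod_closed (cocycles b n).
Proof.
split=> [|a f g]; first by rewrite unfold_in rpred0 linear0 eqxx.
move=> /andP[fC /eqP df] /andP[gC /eqP dg]; apply/andP; split.
  by rewrite rpredD// rpredZ.
by rewrite linearP /= df dg scaler0 addr0.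
Qed.
HB.instance Definition _ b n :=
  GRing.isSubmodClosed.Build R (homog_fun n) (cocycles b n)
    (cocycles_submod b n).

Lemma coboundaries_submod b n : submod_closed (coboundaries b n).
Proof.
case: n => [|n].
  split=> [|a f g]; first by rewrite unfold_in.
  by move=> /eqP-> /eqP->; rewrite unfold_in /= scaler0 addr0.
split=> [|a f g].
  by apply/asboolP; exists 0; rewrite ?rpred0// linear0.
move=> /asboolP[h hC ->] /asboolP[k kC ->]; apply/asboolP.
by exists (a *: h + k); rewrite ?linearP// rpredD// rpredZ.
Qed.

Definition cocycle b n := {f : homog_fun n | f \in cocycles b n}.
HB.instance Definition _ b n := SubType.on (cocycle b n).
HB.instance Definition _ b n := [Choice of cocycle b n by <:].
HB.instance Definition _ b n :=
  [SubChoice_isSubLmodule of cocycle b n by <:].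

Definition exact_cocycles b n : {pred cocycle b n} :=
  fun z => val z \in coboundaries b n.
Arguments exact_cocycles b n z : clear implicits.

Lemma exact_cocycles_submod b n : submod_closed (exact_cocycles b n).
Proof.
have [c0 cP] := coboundaries_submod b n.
split=> [|a u v]; first by rewrite unfold_in linear0.
by rewrite !unfold_in => hu hv; rewrite linearP; exact: cP.
Qed.
HB.instance Definition _ b n :=
  GRing.isSubmodClosed.Build R (cocycle b n) (exact_cocycles b n)
    (exact_cocycles_submod b n).

Definition cohomology b n := lquot (exact_cocycles b n).
HB.instance Definition _ b n :
  EqQuotient (cocycle b n) (Quotient.equiv (lquot_pred (exact_cocycles b n))) (cohomology b n)
  := EqQuotient.on (cohomology b n).
HB.instance Definition _ b n := GRing.Lmodule.on (cohomology b n).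

End Cohomology.

Arguments cochains {R G} b n f.
Arguments cocycles {R G} b n f.
Arguments coboundaries {R G} b n f.
Arguments exact_cocycles {R G} b n z.

Notation H_b R G n := (cohomology R G true n).

Section Comparison.
Variables (R : realType) (G : groupType) (n : nat).

Lemma cochains_forget k (f : homog_fun R G k) :
  f \in cochains true k -> f \in cochains false k.
Proof. by move=> /asboolP[fi _]; apply/asboolP; split. Qed.

Lemma forget_subproof (z : cocycle R G true n) : val z \in cocycles false n.
Proof. by have /andP[/cochains_forget h1 h2] := valP z; apply/andP. Qed.

Definition forget_bound (z : cocycle R G true n) : cocycle R G false n :=
  Sub (val z) (forget_subproof z).

Lemma forget_bound_linear : linear forget_bound.
Proof. by move=> a u v; apply: val_inj; rewrite linearP. Qed.
HB.instance Definition _ :=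
  GRing.isLinear.Build R (cocycle R G true n) (cocycle R G false n) _
    forget_bound forget_bound_linear.

Lemma forget_bound_exact (z : cocycle R G true n) :
  z \in exact_cocycles true n -> forget_bound z \in exact_cocycles false n.
Proof.
rewrite !unfold_in /=; case: z => f /= _; case: n f => [//|k] f.
move=> /asboolP[h hC e]; apply/asboolP.
by exists h => //; exact: cochains_forget.
Qed.

Definition comparison : H_b R G n -> cohomology R G false n :=
  lquot_map forget_bound.

Lemma comparison_linear : linear comparison.
Proof. exact: (lquot_map_linear forget_bound_exact). Qed.
HB.instance Definition _ :=
  GRing.isLinear.Build R (H_b R G n) (cohomology R G false n) _
    comparison comparison_linear.

End Comparison.

Section Pullback.
Variables (R : realType) (G K : groupType) (phi : {multiplicative G -> K}).

Definition pull_fun n (f : homog_fun R K n) : homog_fun R G n :=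
  fun x => f (fun i => phi (x i)).

Lemma pull_cochains b n (f : homog_fun R K n) :
  f \in cochains b n -> pull_fun f \in cochains b n.
Proof.
move=> /asboolP[fi fb]; apply/asboolP; split=> [h x|/fb[M hM]].
  rewrite /pull_fun -[RHS](fi (phi h)); congr (f _).
  by apply/funext => i; rewrite gmulfM.
by exists M => x; exact: hM.
Qed.

Lemma pull_coboundary n (f : homog_fun R K n) :
  coboundary (pull_fun f) = pull_fun (coboundary f).
Proof. by []. Qed.

Lemma pull_cocycle_subproof b n (z : cocycle R K b n) :
  pull_fun (val z) \in cocycles b n.
Proof.
have /andP[h1 /eqP h2] := valP z; apply/andP; split; first exact: pull_cochains.
by rewrite pull_coboundary h2.
Qed.

Definition pull_cocycle b n (z : cocycle R K b n) : cocycle R G b n :=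
  Sub (pull_fun (val z)) (pull_cocycle_subproof z).

Lemma pull_cocycle_linear b n : linear (@pull_cocycle b n).
Proof. by move=> a u v; apply: val_inj; rewrite linearP. Qed.
HB.instance Definition _ b n :=
  GRing.isLinear.Build R (cocycle R K b n) (cocycle R G b n) _
    (@pull_cocycle b n) (@pull_cocycle_linear b n).

Lemma pull_exact b n (z : cocycle R K b n) :
  z \in exact_cocycles b n -> pull_cocycle z \in exact_cocycles b n.
Proof.
rewrite !unfold_in; case: n z => [|k] z /=.
  by move=> /eqP e; apply/eqP; rewrite /= e.
move=> /asboolP[h hC e]; apply/asboolP; exists (pull_fun h).
  exact: pull_cochains.
by rewrite /= e.
Qed.

Definition pullback b n : cohomology R K b n -> cohomology R G b n :=
  lquot_map (@pull_cocycle b n).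

Lemma pullback_linear b n : linear (@pullback b n).
Proof. exact: (lquot_map_linear (@pull_exact b n)). Qed.
HB.instance Definition _ b n :=
  GRing.isLinear.Build R (cohomology R K b n) (cohomology R G b n) _
    (@pullback b n) (@pullback_linear b n).

Lemma pullback_comparison n (x : H_b R K n) :
  comparison (pullback x) = pullback (comparison x).
Proof.
elim/lquotW: x => z; rewrite /comparison /pullback.
rewrite (lquot_mapE (@pull_exact true n)).
rewrite !(lquot_mapE (@forget_bound_exact _ _ n)).
rewrite (lquot_mapE (@pull_exact false n)).
by congr (\pi_ _ _); exact: val_inj.
Qed.

End Pullback.

Section GromovSeminorm.
Variables (R : realType) (G : groupType) (n : nat).
Local Open Scope classical_set_scope.

Definition sup_norm (z : cocycle R G true n) : R :=
  sup [set `|val z x| | x in [set: 'I_n.+1 -> G]].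

Lemma sup_norm_le (z : cocycle R G true n) x : `|val z x| <= sup_norm z.
Proof.
apply: ub_le_sup; last by exists x.
have /andP[/asboolP[_ /(_ isT)[M hM]] _] := valP z.
by exists M => _ [y _ <-]; exact: hM.
Qed.

Lemma sup_norm_ge (z : cocycle R G true n) r :
  (forall x, `|val z x| <= r) -> sup_norm z <= r.
Proof.
move=> h; apply: ge_sup; last by move=> _ [x _ <-].
by exists `|val z (fun=> 1%g)|, (fun=> 1%g).
Qed.

Lemma sup_norm_is_seminorm : is_seminorm sup_norm.
Proof.
have s0 z : 0 <= sup_norm z.
  exact: le_trans (normr_ge0 _) (sup_norm_le z (fun=> 1%g)).
have sZ a z : sup_norm (a *: z) <= `|a| * sup_norm z.
  apply: sup_norm_ge => x; rewrite linearZ -[X in `|X|]/(a * val z x) normrM.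
  by rewrite ler_wpM2l ?sup_norm_le.
split=> // [u v|a z].
  apply: sup_norm_ge => x; rewrite linearD -[X in `|X|]/(val u x + val v x).
  by apply: le_trans (ler_normD _ _) _; rewrite lerD ?sup_norm_le.
apply/eqP; rewrite eq_le sZ /=; have [->|a0] := eqVneq a 0.
  by rewrite normr0 mul0r.
rewrite mulrC -ler_pdivlMr ?normr_gt0// mulrC -normfV.
by rewrite -{1}(scale1r z) -(mulVf a0) -scalerA; exact: sZ.
Qed.

Definition seminorm : H_b R G n -> R := quot_seminorm sup_norm.

Lemma seminorm_is_seminorm : is_seminorm seminorm.
Proof. exact: (quot_seminorm_is_seminorm sup_norm_is_seminorm). Qed.

Definition EH_b_pred : {pred H_b R G n} := fun x => comparison x == 0.

Lemma EH_b_submod : submod_closed EH_b_pred.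
Proof.
split=> [|a x y]; first by rewrite unfold_in linear0.
move=> /eqP x0 /eqP y0; apply/eqP.
by rewrite linearP /= x0 y0 scaler0 addr0.
Qed.
HB.instance Definition _ :=
  GRing.isSubmodClosed.Build R (H_b R G n) EH_b_pred EH_b_submod.

Definition EH_b := {x : H_b R G n | x \in EH_b_pred}.
HB.instance Definition _ := SubType.on EH_b.
HB.instance Definition _ := [Choice of EH_b by <:].
HB.instance Definition _ := [SubChoice_isSubLmodule of EH_b by <:].

Definition EH_b_seminorm (x : EH_b) : R := seminorm (val x).

Lemma EH_b_seminorm_is_seminorm : is_seminorm EH_b_seminorm.
Proof.
have [p0 pD pZ] := seminorm_is_seminorm.
split=> [x|x y|a x]; rewrite /EH_b_seminorm ?linearD ?linearZ.
- exact: p0.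
- exact: pD.
- exact: pZ.
Qed.

Definition null_classes : {pred H_b R G n} := fun x => seminorm x == 0.

(* EH_b \cap N as a subspace of EH_b *)
Definition EH_b_null : {pred EH_b} := fun x => val x \in null_classes.
HB.instance Definition _ := GRing.isSubmodClosed.Build R EH_b EH_b_null
  (seminorm_zero_submod EH_b_seminorm_is_seminorm).

Definition EHbar := lquot EH_b_null.
HB.instance Definition _ : EqQuotient EH_b
  (Quotient.equiv (lquot_pred EH_b_null)) EHbar := EqQuotient.on EHbar.
HB.instance Definition _ := GRing.Lmodule.on EHbar.

Definition EHbar_norm : EHbar -> R := quot_seminorm EH_b_seminorm.

End GromovSeminorm.

Arguments EH_b R G n : clear implicits.
Arguments EHbar R G n : clear implicits.

Section PullbackEHbar.
Variables (R : realType) (G K : groupType) (phi : {multiplicative G -> K}).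
Variable n : nat.

Lemma pull_EH_b_subproof (x : EH_b R K n) :
  pullback phi (val x) \in @EH_b_pred R G n.
Proof.
rewrite unfold_in pullback_comparison.
by have /eqP-> := valP x; rewrite linear0.
Qed.

Definition pull_EH_b (x : EH_b R K n) : EH_b R G n :=
  Sub (pullback phi (val x)) (pull_EH_b_subproof x).

Lemma pull_EH_b_linear : linear pull_EH_b.
Proof. by move=> a x y; apply: val_inj; rewrite /= !linearP. Qed.
HB.instance Definition _ :=
  GRing.isLinear.Build R (EH_b R K n) (EH_b R G n) _ pull_EH_b pull_EH_b_linear.

Lemma seminorm_pullback (x : H_b R K n) : seminorm (pullback phi x) <= seminorm x.
Proof.
apply: quot_seminorm_ge => z <-; rewrite /seminorm /pullback.
rewrite (lquot_mapE (@pull_exact _ _ _ phi true n)).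
apply: le_trans (quot_seminorm_le (sup_norm_is_seminorm R G n) _) _.
by apply: sup_norm_ge => y; exact: (sup_norm_le z (fun i => phi (y i))).
Qed.

Lemma pull_EH_b_null (x : EH_b R K n) :
  x \in @EH_b_null R K n -> pull_EH_b x \in @EH_b_null R G n.
Proof.
rewrite !unfold_in => /eqP x0; have [p0 _ _] := seminorm_is_seminorm R G n.
by rewrite eq_le p0 andbT -x0; exact: seminorm_pullback.
Qed.

Definition pullback_EHbar : EHbar R K n -> EHbar R G n := lquot_map pull_EH_b.

Lemma pullback_EHbar_linear : linear pullback_EHbar.
Proof. exact: (lquot_map_linear pull_EH_b_null). Qed.
HB.instance Definition _ :=
  GRing.isLinear.Build R (EHbar R K n) (EHbar R G n) _
    pullback_EHbar pullback_EHbar_linear.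

End PullbackEHbar.

(* Main.v *)
(* For a group H, averaging a cochain over the two coordinates maps cochains of
   H to cochains of the wreath product H wr Z/2; it commutes with coboundaries,
   does not increase norms, and is the identity after restriction to the
   diagonal.  Killing c_2, ..., c_m and sending c_1 to ((1, [b, a]), swap),
   whose square is the diagonal element [b, a], extends the diagonal embedding
   of F2 to a homomorphism pi1_N g -> F2 wr Z/2.  Pulling back along it gives
   the section.  Geometrically, for g = 3 it is half the transfer of the
   orientation double cover N_3 <- Sigma_2, applied to the class pulled back
   along the folding of Sigma_2 onto the once-holed torus. *)
From HB Require Import structures.
Require Import Defs.
From mathcomp Require Import all_boot all_order all_algebra.
From mathcomp Require Import boolp classical_sets functions reals.
Set Implicit Arguments.
Unset Strict Implicit.
Unset Printing Implicit Defensive.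
Import Order.TTheory GRing.Theory Num.Theory.
Local Open Scope ring_scope.
Local Open Scope quotient_scope.

(** * Homomorphisms out of a presented group *)

Section PresentedLift.
Variables (X : choiceType) (rel : set (word X)) (H : groupType) (f : X -> H).
Hypothesis f_rel : forall r, rel r -> word_eval f r = 1%g.

(** Von Dyck's criterion: evaluation respects each generating rule of [word_eq], the relator rule
    being exactly [f_rel]. *)
Lemma presented_word_eval_eq u v :
  word_eq rel u v -> word_eval f u = word_eval f v.
Proof.
elim=> // [a b c _ -> _ -> //|a a' b b' _ h1 _ h2|x []].
- by rewrite !word_eval_cat h1 h2.
- by rewrite /= mulg1 mulVg.
- by rewrite /= mulg1 mulgV.
Qed.

Definition presented_lift (x : presented rel) : H := word_eval f (repr x).

Lemma presented_lift_pi u :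
  presented_lift (\pi_(presented rel) u) = word_eval f u.
Proof. by apply: presented_word_eval_eq; exact: presented_repr. Qed.

Lemma presented_liftM : {morph presented_lift : x y / (x * y)%g}.
Proof.
move=> x y; elim/presentedW: x => u; elim/presentedW: y => v.
by rewrite [(_ * _)%g]presented_mulE !presented_lift_pi word_eval_cat.
Qed.

End PresentedLift.

(** * The wreath product with Z/2 *)

Section Wreath.
Variable H : groupType.

(** The last component is the element of Z/2, with [true] for the swap. *)
Definition wreath : Type := (H * H * bool)%type.
HB.instance Definition _ := Choice.on wreath.

Definition wreath_one : wreath := (1%g, 1%g, false).
Definition wreath_mul (x y : wreath) : wreath :=
  let: (p, q, e) := x in let: (p', q', e') := y in
  if e then ((p * q')%g, (q * p')%g, ~~ e') else ((p * p')%g, (q * q')%g, e').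
Definition wreath_inv (x : wreath) : wreath :=
  let: (p, q, e) := x in
  if e then ((q^-1)%g, (p^-1)%g, true) else ((p^-1)%g, (q^-1)%g, false).

Let mulA : associative wreath_mul.
Proof.
by move=> [[p q] []] [[p' q'] []] [[p'' q''] e]; rewrite /= !mulgA ?negbK.
Qed.
Let mul1 : left_id wreath_one wreath_mul.
Proof. by move=> [[p q] e]; rewrite /= !mul1g. Qed.
Let mulr1 : right_id wreath_one wreath_mul.
Proof. by move=> [[p q] []]; rewrite /= !mulg1. Qed.
Let mulV : left_inverse wreath_one wreath_inv wreath_mul.
Proof. by move=> [[p q] []]; rewrite /= !mulVg. Qed.
Let mulrV : right_inverse wreath_one wreath_inv wreath_mul.
Proof. by move=> [[p q] []]; rewrite /= !mulgV. Qed.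
HB.instance Definition _ :=
  isGroup.Build wreath mulA mul1 mulr1 mulV mulrV.

Definition wreath_diag (h : H) : wreath := (h, h, false).

Lemma wreath_diag_inj : injective wreath_diag.
Proof. by move=> x y []. Qed.

End Wreath.

(** * Averaging cochains over the two coordinates *)

Section WreathAverage.
Variables (R : realType) (H : groupType).

Definition wreath_fun n (f : homog_fun R H n) : homog_fun R (wreath H) n :=
  fun x => 2^-1 * (f (fun i => (x i).1.1) + f (fun i => (x i).1.2)).

Lemma wreath_fun_linear n : linear (@wreath_fun n).
Proof.
(* Stated for scalars; the operations on [homog_fun] reduce to it pointwise by conversion. *)
have avgP (a p q r s : R) : 2^-1 * ((a * p + r) + (a * q + s)) =
    a * (2^-1 * (p + q)) + 2^-1 * (r + s).
  by rewrite addrACA -mulrDr [LHS]mulrDr [in LHS]mulrCA.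
by move=> a f g; apply/funext => x; exact: avgP.
Qed.
HB.instance Definition _ n :=
  GRing.isLinear.Build R (homog_fun R H n) (homog_fun R (wreath H) n) _
    (@wreath_fun n) (@wreath_fun_linear n).

Lemma wreath_fun_le n (f : homog_fun R H n) (M : R) :
  (forall x, `|f x| <= M) -> forall x, `|wreath_fun f x| <= M.
Proof.
move=> fM x; rewrite /wreath_fun normrM ger0_norm ?invr_ge0//.
rewrite mulrC ler_pdivrMr// mulr_natr mulr2n.
by apply: le_trans (ler_normD _ _) _; rewrite lerD.
Qed.

(** A coordinate alone is not a homomorphism on the wreath product, and composing [f] with it need
    not give an invariant function. The swap only permutes the two summands, so their sum is
    invariant. *)
Lemma wreath_cochains b n (f : homog_fun R H n) :
  f \in cochains b n -> wreath_fun f \in cochains b n.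
Proof.
move=> /asboolP[fi fb]; apply/asboolP; split=> [[[p q] e] x|/fb[M hM]].
  rewrite /wreath_fun; congr (_ * _); case: e.
    (* With a swap, p multiplies the second coordinates and q the first, hence the exchange of
       summands before using the invariance of [f]. *)
    rewrite addrC -(fi q (fun i => (x i).1.1)) -(fi p (fun i => (x i).1.2)).
    by congr (f _ + f _); apply/funext => i; case: (x i) => [[]].
  rewrite -(fi p (fun i => (x i).1.1)) -(fi q (fun i => (x i).1.2)).
  by congr (f _ + f _); apply/funext => i; case: (x i) => [[]].
by exists M; exact: wreath_fun_le.
Qed.

Lemma wreath_coboundary n (f : homog_fun R H n) :
  coboundary (wreath_fun f) = wreath_fun (coboundary f).
Proof.
apply/funext => x; rewrite /wreath_fun /coboundary -big_split mulr_sumr.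
by apply: eq_bigr => i _; rewrite mulrCA mulrDr.
Qed.

Lemma wreath_cocycle_subproof b n (z : cocycle R H b n) :
  wreath_fun (val z) \in cocycles b n.
Proof.
have /andP[h1 /eqP h2] := valP z; apply/andP; split.
  exact: wreath_cochains.
by rewrite wreath_coboundary h2 linear0.
Qed.

Definition wreath_cocycle b n (z : cocycle R H b n) :
    cocycle R (wreath H) b n :=
  Sub (wreath_fun (val z)) (wreath_cocycle_subproof z).

Lemma wreath_cocycle_linear b n : linear (@wreath_cocycle b n).
Proof. by move=> a u v; apply: val_inj; rewrite /= !linearP. Qed.
HB.instance Definition _ b n :=
  GRing.isLinear.Build R (cocycle R H b n) (cocycle R (wreath H) b n) _
    (@wreath_cocycle b n) (@wreath_cocycle_linear b n).

Lemma wreath_exact b n (z : cocycle R H b n) :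
  z \in exact_cocycles b n -> wreath_cocycle z \in exact_cocycles b n.
Proof.
rewrite !unfold_in; case: n z => [|k] z /=.
  by move=> /eqP e; apply/eqP; rewrite /= e linear0.
move=> /asboolP[h hC e]; apply/asboolP; exists (wreath_fun h).
  exact: wreath_cochains.
by rewrite /= e wreath_coboundary.
Qed.

Definition wreath_average b n :
    cohomology R H b n -> cohomology R (wreath H) b n :=
  lquot_map (@wreath_cocycle b n).

Lemma wreath_average_linear b n : linear (@wreath_average b n).
Proof. exact: (lquot_map_linear (@wreath_exact b n)). Qed.
HB.instance Definition _ b n :=
  GRing.isLinear.Build R (cohomology R H b n) (cohomology R (wreath H) b n) _
    (@wreath_average b n) (@wreath_average_linear b n).

(** The same formula averages bounded and arbitrary cochains; this is what lets the section preserve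
    the kernel of the comparison map. *)
Lemma wreath_average_comparison n (x : H_b R H n) :
  comparison (wreath_average x) = wreath_average (comparison x).
Proof.
elim/lquotW: x => z; rewrite /comparison /wreath_average.
rewrite (lquot_mapE (@wreath_exact true n)).
rewrite !(lquot_mapE (@forget_bound_exact _ _ n)).
rewrite (lquot_mapE (@wreath_exact false n)).
by congr (\pi_ _ _); exact: val_inj.
Qed.

Lemma seminorm_wreath_average n (x : H_b R H n) :
  seminorm (wreath_average x) <= seminorm x.
Proof.
apply: quot_seminorm_ge => z <-; rewrite /seminorm /wreath_average.
rewrite (lquot_mapE (@wreath_exact true n)).
apply: le_trans (quot_seminorm_le (sup_norm_is_seminorm R (wreath H) n) _) _.
by apply: sup_norm_ge; apply: wreath_fun_le; exact: sup_norm_le.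
Qed.

End WreathAverage.

(** * The isometric section attached to an extension of the diagonal embedding *)

Section WreathSection.
Variables (R : realType) (H G : groupType).
Variables (i : {multiplicative H -> G}) (psi : {multiplicative G -> wreath H}).
Hypothesis psi_i : forall h, psi (i h) = wreath_diag h.
Variable n : nat.

Definition wreath_section (x : H_b R H n) : H_b R G n :=
  pullback psi (wreath_average x).

Lemma seminorm_wreath_section_le x : seminorm (wreath_section x) <= seminorm x.
Proof.
exact: le_trans (seminorm_pullback _ _) (seminorm_wreath_average _).
Qed.

Lemma wreath_section_linear : linear wreath_section.
Proof. by move=> a x y; rewrite /wreath_section !linearP. Qed.
HB.instance Definition _ :=
  GRing.isLinear.Build R (H_b R H n) (H_b R G n) _
    wreath_section wreath_section_linear.

(** The identity already holds for cocycles: by [psi_i] both coordinates of [psi (i h)] are [h], so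
    a value is averaged with itself. *)
Lemma pullback_wreath_section x : pullback i (wreath_section x) = x.
Proof.
elim/lquotW: x => z; rewrite /wreath_section /wreath_average /pullback.
rewrite (lquot_mapE (@wreath_exact _ _ true n)).
rewrite (lquot_mapE (@pull_exact _ _ _ psi true n)).
rewrite (lquot_mapE (@pull_exact _ _ _ i true n)).
congr (\pi_ _ _); apply/val_inj/funext => x /=.
rewrite /pull_fun /wreath_fun.
have -> : (fun j => (psi (i (x j))).1.1) = x.
  by apply/funext => j; rewrite psi_i.
have -> : (fun j => (psi (i (x j))).1.2) = x.
  by apply/funext => j; rewrite psi_i.
have avg_id (r : R) : 2^-1 * (r + r) = r.
  by rewrite -mulr2n -[r *+ 2]mulr_natl mulKf ?pnatr_eq0.
exact: avg_id.
Qed.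

(** Neither the section nor the restriction along [i] increases the seminorm, and the restriction
    undoes the section. *)
Lemma seminorm_wreath_section x : seminorm (wreath_section x) = seminorm x.
Proof.
apply/eqP; rewrite eq_le seminorm_wreath_section_le /=.
by rewrite -{1}[x]pullback_wreath_section seminorm_pullback.
Qed.

Lemma wreath_section_EH_b_subproof (x : EH_b R H n) :
  wreath_section (val x) \in @EH_b_pred R G n.
Proof.
rewrite unfold_in pullback_comparison wreath_average_comparison.
by have /eqP-> := valP x; rewrite !linear0.
Qed.

Definition wreath_section_EH_b (x : EH_b R H n) : EH_b R G n :=
  Sub (wreath_section (val x)) (wreath_section_EH_b_subproof x).

Lemma wreath_section_EH_b_linear : linear wreath_section_EH_b.
Proof. by move=> a x y; apply: val_inj; rewrite /= !linearP. Qed.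
HB.instance Definition _ :=
  GRing.isLinear.Build R (EH_b R H n) (EH_b R G n) _
    wreath_section_EH_b wreath_section_EH_b_linear.

Lemma wreath_section_EH_b_null (x : EH_b R H n) :
  x \in @EH_b_null R H n -> wreath_section_EH_b x \in @EH_b_null R G n.
Proof.
rewrite !unfold_in => /eqP x0; have [p0 _ _] := seminorm_is_seminorm R G n.
by rewrite eq_le p0 andbT -x0; exact: seminorm_wreath_section_le.
Qed.

Definition wreath_section_EHbar : EHbar R H n -> EHbar R G n :=
  lquot_map wreath_section_EH_b.

Lemma wreath_section_EHbar_linear : linear wreath_section_EHbar.
Proof. exact: (lquot_map_linear wreath_section_EH_b_null). Qed.
HB.instance Definition _ :=
  GRing.isLinear.Build R (EHbar R H n) (EHbar R G n) _
    wreath_section_EHbar wreath_section_EHbar_linear.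

Lemma wreath_section_EHbarE x :
  wreath_section_EHbar (\pi_(EHbar R H n) x) =
  \pi_(EHbar R G n) (wreath_section_EH_b x).
Proof. exact: (lquot_mapE wreath_section_EH_b_null). Qed.

Lemma pullback_wreath_section_EHbar x :
  pullback_EHbar i (wreath_section_EHbar x) = x.
Proof.
elim/lquotW: x => x; rewrite wreath_section_EHbarE /pullback_EHbar.
rewrite (lquot_mapE (@pull_EH_b_null _ _ _ i n)).
by congr (\pi_ _ _); apply: val_inj; rewrite /= pullback_wreath_section.
Qed.

Lemma EHbar_norm_wreath_section x :
  EHbar_norm (wreath_section_EHbar x) = EHbar_norm x.
Proof.
apply/eqP; rewrite eq_le; apply/andP; split; apply: quot_seminorm_ge => y.
  (* Upper bound: the section carries each representative of [x] to one of the image, with the same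
     seminorm. *)
  move=> <-; rewrite wreath_section_EHbarE; apply: le_trans.
    exact: (quot_seminorm_le (EH_b_seminorm_is_seminorm R G n)).
  by rewrite /EH_b_seminorm /= seminorm_wreath_section.
(* Lower bound: a representative of the image restricts along [i] to one of [x], with no larger
   seminorm. *)
move=> yx; rewrite -[x]pullback_wreath_section_EHbar -yx /pullback_EHbar.
rewrite (lquot_mapE (@pull_EH_b_null _ _ _ i n)).
apply: le_trans (seminorm_pullback i (val y)).
exact: (quot_seminorm_le (EH_b_seminorm_is_seminorm R H n)).
Qed.

End WreathSection.

(** * The surface group mapped to the wreath product of F2 *)

Definition surface_to_wreath_gen m (s : 'I_2 + 'I_m) : wreath F2 :=
  let a : F2 := gen set0 ord0 in
  let b : F2 := gen set0 ord_max in
  match s with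
  | inl j => wreath_diag (gen set0 j : F2)
  | inr j => if val j == 0%N
             then ((1%g : F2, (b * a * b^-1 * a^-1)%g, true) : wreath F2)
             else 1%g
  end.

(** Positivity of [m] provides c_1, whose image squares to the diagonal [b, a]; every other c_j
    evaluates to 1. *)
Lemma word_eval_squares m : (0 < m)%N ->
  word_eval (@surface_to_wreath_gen m)
    (flatten [seq [:: (inr j, false); (inr j, false)] | j <- enum 'I_m]) =
  wreath_diag (gen set0 ord_max * gen set0 ord0 *
               (gen set0 ord_max)^-1 * (gen set0 ord0)^-1 : F2)%g.
Proof.
case: m => // m _; rewrite enum_ordSl /=.
have -> : word_eval (@surface_to_wreath_gen m.+1)
    (flatten [seq [:: (inr j, false); (inr j, false)] |
                j <- [seq lift ord0 i | i <- enum 'I_m]]) = 1%g.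
  by elim: (enum _) => //= j s ->; rewrite !mul1g.
by rewrite mulg1 /= [(_ * _)%g]/(wreath_mul _ _) /= mulg1 mul1g.
Qed.

Section SurfaceGroup.
Variable g : nat.
Hypothesis hg : (3 <= g)%N.

Lemma surface_to_wreath_rel (r : word (surface_gen g)) :
  [set surface_relator g]%classic r ->
  word_eval (@surface_to_wreath_gen (g - 2)) r = 1%g.
Proof.
move=> ->; rewrite /surface_relator word_eval_cat.
rewrite word_eval_squares ?subn_gt0//.
set a : F2 := gen set0 ord0; set b : F2 := gen set0 ord_max.
rewrite /= mulg1.
(* All factors are diagonal, so what remains is [a, b] [b, a] = 1 in F2. *)
rewrite -[LHS]/(wreath_diag
  (a * (b * (a^-1 * b^-1)) * (b * a * b^-1 * a^-1))%g).
rewrite (_ : (_ * _)%g = 1%g)//.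
by rewrite !mulgA mulgVK mulgVK mulgK mulgV.
Qed.

Definition surface_to_wreath : {multiplicative pi1_N g -> wreath F2} :=
  HB.pack
    (presented_lift (@surface_to_wreath_gen (g - 2)) : pi1_N g -> wreath F2)
    (isMultiplicative.Build (pi1_N g) (wreath F2) _
      (presented_liftM surface_to_wreath_rel)).

Lemma surface_to_wreath_i_star h :
  surface_to_wreath (i_star g h) = wreath_diag h.
Proof.
elim/presentedW: h => u; rewrite /i_star free_lift_pi.
(* On words, [i_star] only relabels each letter through [inl], so the lift can then be evaluated
   letter by letter. *)
have -> :
    word_eval (fun s : 'I_2 => gen [set surface_relator g]%classic (inl s)) u =
    \pi_(presented _) [seq (inl l.1, l.2) | l <- u].
  by elim: u => //= -[s []] u ->; rewrite /gen ?pi_invg pi_mulg.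
rewrite [LHS](presented_lift_pi surface_to_wreath_rel).
elim: u => //= -[s e] u ->; rewrite -cat1s -pi_mulg /=.
case: e => //=.
by rewrite -[_^-1%g]/(wreath_diag (gen set0 s)^-1%g) /gen pi_invg.
Qed.

(** Composing with [surface_to_wreath] gives the diagonal embedding, which is injective. *)
Lemma i_star_inj : injective (i_star g).
Proof.
move=> x y xy; apply: wreath_diag_inj.
by rewrite -!surface_to_wreath_i_star xy.
Qed.

End SurfaceGroup.

Theorem proposition4p10 (R : realType) (g n : nat)
    (hg : (3 <= g)%N) (hn : (2 <= n)%N) :
  injective (i_star g) /\
  (exists J : {linear H_b R F2 n -> H_b R (pi1_N g) n},
    (forall x, seminorm (J x) = seminorm x) /\
    (forall x, pullback (i_star g) (J x) = x) /\
    (exists Jbar : {linear EHbar R F2 n -> EHbar R (pi1_N g) n},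
      (forall x : EH_b R F2 n, exists y : EH_b R (pi1_N g) n,
         val y = J (val x) /\
         Jbar (\pi_(EHbar R F2 n) x) = \pi_(EHbar R (pi1_N g) n) y) /\
      (forall x, EHbar_norm (Jbar x) = EHbar_norm x) /\
      (forall x, pullback_EHbar (i_star g) (Jbar x) = x))) /\
  (forall y : EHbar R F2 n, exists x : EHbar R (pi1_N g) n,
     pullback_EHbar (i_star g) x = y).
Proof.
have psi_i := surface_to_wreath_i_star hg.
split; first exact: i_star_inj hg.
split; last first.
  (* Surjectivity: the reduced section itself supplies a preimage. *)
  move=> y; exists (wreath_section_EHbar (surface_to_wreath hg) y).
  exact: (pullback_wreath_section_EHbar psi_i).
exists (@wreath_section R _ _ (surface_to_wreath hg) n); split.
  exact: (seminorm_wreath_section psi_i).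
split; first exact: (pullback_wreath_section psi_i).
exists (@wreath_section_EHbar R _ _ (surface_to_wreath hg) n); split.
  (* The value of this witness is the section of [val x] by definition. *)
  move=> x; exists (wreath_section_EH_b (surface_to_wreath hg) x); split=> //.
  exact: wreath_section_EHbarE.
split=> x; last exact: (pullback_wreath_section_EHbar psi_i).
exact: (EHbar_norm_wreath_section psi_i).
Qed.
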